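(* Let $\Gamma$ be a generalized Hantzsche-Wendt group of dimension $n$. Then $|\mathrm{Out}(\Gamma)|\le 2^{n+1}\,n!$. Moreover, if $\Gamma$ has non-trivial center, then $|\mathrm{Out}(\Gamma)|\le 2^{n}\,(n-1)!$.
   Context: A Bieberbach group of dimension $n$ is a torsion-free, discrete, cocompact subgroup $\Gamma$ of $\mathrm{E}(n)=\mathrm{O}(n)\ltimes\mathbb{R}^n$, the group of rigid motions of $\mathbb{R}^n$. Its translation subgroup $\Lambda\cong\mathbb{Z}^n$ is normal of finite index, and $\Gamma/\Lambda$ is its holonomy group. The group $\Gamma$ is a generalized Hantzsche-Wendt (GHW) group if its holonomy group is isomorphic to $\mathbb{Z}_2^{\,n-1}$. $\mathrm{Out}(\Gamma)=\mathrm{Aut}(\Gamma)/\mathrm{Inn}(\Gamma)$, and $|A|$ denotes the order of a group $A$. *)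

(* Defs.v *)
From HB Require Import structures.
From mathcomp Require Import all_boot all_order all_algebra.
From mathcomp Require Import all_classical all_reals topology normedtype.

Set Implicit Arguments.
Unset Strict Implicit.
Unset Printing Implicit Defensive.

Import GRing.Theory Num.Theory.
Import numFieldNormedType.Exports.

Local Open Scope classical_set_scope.
Local Open Scope quotient_scope.
Local Open Scope group_scope.

Section Subgroup.
Variables (G : groupType) (H : groupClosed G).

Definition subgroup : Type := {x : G | x \in H}.

HB.instance Definition _ := SubChoice.on subgroup.

Lemma subgroup_closed_subproof : group_closed H.
Proof. by split; [exact: gpred1 | move=> x y; exact: gpredF]. Qed.

HB.instance Definition _ :=
  SubChoice_isSubGroup.Build G (mem H) subgroup subgroup_closed_subproof.

End Subgroup.

Section CosetSpace.
Variables (G : groupType) (H : groupClosed G).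

Definition lcoset_rel : rel G := fun x y => x^-1 * y \in H.

Lemma lcoset_refl : reflexive lcoset_rel.
Proof. by move=> x; rewrite /lcoset_rel mulVg gpred1. Qed.

Lemma lcoset_sym : symmetric lcoset_rel.
Proof. by move=> x y; rewrite /lcoset_rel -gpredV invgM invgK. Qed.

Lemma lcoset_trans : transitive lcoset_rel.
Proof.
move=> y x z xy yz; rewrite /lcoset_rel -(mulgK y x^-1) -mulgA.
exact: gpredM.
Qed.

Canonical lcoset_equiv := EquivRel lcoset_rel lcoset_refl lcoset_sym lcoset_trans.

Definition coset_space : Type := {eq_quot lcoset_equiv}.

HB.instance Definition _ := Choice.on coset_space.
HB.instance Definition _ := EqQuotient.on coset_space.

End CosetSpace.

HB.mixin Record isConjClosed (G : groupType) (N : {pred G}) := {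
  gpredJr : forall x y : G, x \in N -> x ^ y \in N
}.

#[short(type="normalClosed")]
HB.structure Definition NormalClosed (G : groupType) :=
  {N of GroupClosed G N & isConjClosed G N}.

Section QuotientGroup.
Variables (G : groupType) (N : normalClosed G).

Definition quotient_group : Type := coset_space N.

HB.instance Definition _ := Choice.on quotient_group.
HB.instance Definition _ := EqQuotient.on quotient_group.

Local Notation Q := quotient_group.

Definition quotient_mul : Q -> Q -> Q := lift_op2 Q (fun x y : G => x * y).
Definition quotient_one : Q := \pi 1.
Definition quotient_inv : Q -> Q := lift_op1 Q (fun x : G => x^-1).

Lemma pi_quotient_eqP (x y : G) : reflect (\pi_Q x = \pi_Q y) (x^-1 * y \in N).
Proof. exact: (@eqmodP G (lcoset_equiv N) x y). Qed.

Lemma pi_quotient_mul : {morph \pi_Q : x y / x * y >-> quotient_mul x y}.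
Proof.
move=> x y; unlock quotient_mul; apply/pi_quotient_eqP.
set x' := repr _; set y' := repr _.
have xx' : x^-1 * x' \in N by apply/pi_quotient_eqP; rewrite reprK.
have yy' : y^-1 * y' \in N by apply/pi_quotient_eqP; rewrite reprK.
have -> : (x * y)^-1 * (x' * y') = (x^-1 * x') ^ y * (y^-1 * y').
  by rewrite /conjg invgM !mulgA mulgK.
by apply: gpredM => //; exact: gpredJr.
Qed.

Lemma pi_quotient_inv : {morph \pi_Q : x / x^-1 >-> quotient_inv x}.
Proof.
move=> x; unlock quotient_inv; apply/pi_quotient_eqP.
set x' := repr _.
have xx' : x'^-1 * x \in N by apply/pi_quotient_eqP; rewrite reprK.
have -> : x^-1^-1 * x'^-1 = (x'^-1 * x) ^ x'^-1.
  by rewrite /conjg !invgK !mulgA mulgV mul1g.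
exact: gpredJr.
Qed.

Lemma quotient_mulA : associative quotient_mul.
Proof.
move=> x y z; rewrite -[x]reprK -[y]reprK -[z]reprK.
by rewrite -!pi_quotient_mul mulgA.
Qed.

Lemma quotient_mul1 : left_id quotient_one quotient_mul.
Proof. by move=> x; rewrite -[x]reprK -pi_quotient_mul mul1g. Qed.

Lemma quotient_mulr1 : right_id quotient_one quotient_mul.
Proof. by move=> x; rewrite -[x]reprK -pi_quotient_mul mulg1. Qed.

Lemma quotient_mulV : left_inverse quotient_one quotient_inv quotient_mul.
Proof.
by move=> x; rewrite -[x]reprK -pi_quotient_inv -pi_quotient_mul mulVg.
Qed.

Lemma quotient_mulrV : right_inverse quotient_one quotient_inv quotient_mul.
Proof.
by move=> x; rewrite -[x]reprK -pi_quotient_inv -pi_quotient_mul mulgV.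
Qed.

HB.instance Definition _ := isGroup.Build quotient_group
  quotient_mulA quotient_mul1 quotient_mulr1 quotient_mulV quotient_mulrV.

End QuotientGroup.

Definition isomorphic (G H : groupType) :=
  exists f : {multiplicative G -> H}, bijective f.

Definition torsion_free (G : groupType) :=
  forall (g : G) (k : nat), (0 < k)%N -> g ^+ k = 1 -> g = 1.

Definition center (G : groupType) : set G :=
  [set z | forall g : G, commute z g].
Arguments center : clear implicits.

Section Automorphisms.
Variable G : groupType.

Definition is_automorphism (f : G -> G) : bool :=
  `[< {morph f : x y / x * y} /\ bijective f >].

Definition automorphism_group : Type := {f : G -> G | is_automorphism f}.

HB.instance Definition _ := SubChoice.on automorphism_group.

Implicit Types f g h : automorphism_group.

Lemma autM f : {morph val f : x y / x * y}.
Proof. by have /asboolP[] := valP f. Qed.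

Lemma aut_bij f : bijective (val f).
Proof. by have /asboolP[] := valP f. Qed.

Lemma aut_comp_subproof f g : is_automorphism (val f \o val g).
Proof.
apply/asboolP; split; first by move=> x y; rewrite /= !autM.
by apply: bij_comp; exact: aut_bij.
Qed.

Lemma aut_id_subproof : is_automorphism idfun.
Proof. by apply/asboolP; split=> //; exists idfun. Qed.

Lemma aut_inv_exists f : exists g : automorphism_group, cancel (val f) (val g).
Proof.
have [g fK gK] := aut_bij f.
suff gP : is_automorphism g by exists (Sub g gP); rewrite SubK.
apply/asboolP; split; last by exists (val f).
by move=> x y; apply: (can_inj fK); rewrite autM !gK.
Qed.

Definition aut_mul f g : automorphism_group := Sub (val f \o val g) (aut_comp_subproof f g).
Definition aut_one : automorphism_group := Sub idfun aut_id_subproof.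
Definition aut_inv f : automorphism_group := projT1 (cid (aut_inv_exists f)).

Lemma aut_invK f : cancel (val f) (val (aut_inv f)).
Proof. exact: projT2 (cid (aut_inv_exists f)). Qed.

Lemma aut_mulA : associative aut_mul.
Proof. by move=> f g h; apply: val_inj. Qed.

Lemma aut_mul1 : left_id aut_one aut_mul.
Proof. by move=> f; apply: val_inj. Qed.

Lemma aut_mulr1 : right_id aut_one aut_mul.
Proof. by move=> f; apply: val_inj. Qed.

Lemma aut_mulV : left_inverse aut_one aut_inv aut_mul.
Proof. by move=> f; apply: val_inj; apply/funext => x; exact: aut_invK. Qed.

Lemma aut_mulrV : right_inverse aut_one aut_inv aut_mul.
Proof.
move=> f; apply: val_inj; apply/funext => x.
have [g fK gK] := aut_bij f.
by rewrite /= -[x in val (aut_inv f) x]gK aut_invK gK.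
Qed.

HB.instance Definition _ := isGroup.Build automorphism_group
  aut_mulA aut_mul1 aut_mulr1 aut_mulV aut_mulrV.

Definition inner_automorphism : {pred automorphism_group} :=
  fun f => `[< exists a : G, forall x, val f x = a * x * a^-1 >].

Lemma inner_automorphismP f :
  reflect (exists a : G, forall x, val f x = a * x * a^-1)
    (f \in inner_automorphism).
Proof. exact: asboolP. Qed.

Lemma inner_mulg_closed : mulg_closed inner_automorphism.
Proof.
move=> f g /inner_automorphismP[a fa] /inner_automorphismP[b gb]; apply/inner_automorphismP; exists (a * b) => x.
by rewrite /= fa gb invgM !mulgA.
Qed.

Lemma inner_1 : 1 \in inner_automorphism.
Proof. by apply/inner_automorphismP; exists 1 => x; rewrite mul1g invg1 mulg1. Qed.

Lemma inner_invg_closed : invg_closed inner_automorphism.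
Proof.
move=> f /inner_automorphismP[a fa]; apply/inner_automorphismP; exists a^-1 => x.
rewrite -[x in LHS](_ : val f (a^-1 * x * a^-1^-1) = x); first exact: aut_invK.
by rewrite fa !mulgA mulgV mul1g invgK mulgK.
Qed.

HB.instance Definition _ := isMulClosed.Build automorphism_group inner_automorphism inner_mulg_closed.
HB.instance Definition _ := isMul1Closed.Build automorphism_group inner_automorphism inner_1.
HB.instance Definition _ := isInvClosed.Build automorphism_group inner_automorphism inner_invg_closed.

Lemma inner_conj f h : f \in inner_automorphism -> f ^ h \in inner_automorphism.
Proof.
move=> /inner_automorphismP[a fa]; apply/inner_automorphismP; exists (val h^-1 a) => x.
have hK y : val h^-1 (val h y) = y by exact: aut_invK.
have V y : val h^-1 y^-1 = (val h^-1 y)^-1.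
  apply: (mulgI (val h^-1 y)); rewrite -autM !mulgV.
  by apply: (mulgI (val h^-1 1)); rewrite -autM !mulg1.
by rewrite /conjg /= fa !autM V hK.
Qed.

HB.instance Definition _ := isConjClosed.Build automorphism_group inner_automorphism inner_conj.

Definition Out := quotient_group inner_automorphism.

HB.instance Definition _ := Group.on Out.

End Automorphisms.

Section RigidMotions.
Variables (R : realType) (n : nat).
Local Open Scope ring_scope.

Definition is_rigid (p : 'M[R]_n * 'cV[R]_n) : bool := p.1 *m p.1^T == 1%:M.

(* The pair (A, a) with A orthogonal stands for the motion x |-> A x + a. *)
Definition rigid_motion : Type := {p : 'M[R]_n * 'cV[R]_n | is_rigid p}.

HB.instance Definition _ := SubChoice.on rigid_motion.
HB.instance Definition _ := Topological.copy rigid_motion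
  (initial_topology (val : rigid_motion -> 'M[R]_n * 'cV[R]_n)).

Definition linear_part (g : rigid_motion) : 'M[R]_n := (val g).1.
Definition translation_part (g : rigid_motion) : 'cV[R]_n := (val g).2.

Implicit Types g h : rigid_motion.

Lemma linear_part_mulmxtr g : linear_part g *m (linear_part g)^T = 1%:M.
Proof. exact/eqP/(valP g). Qed.

Lemma linear_part_trmulmx g : (linear_part g)^T *m linear_part g = 1%:M.
Proof. exact/mulmx1C/linear_part_mulmxtr. Qed.

Lemma rigid_mul_subproof g h : is_rigid
  (linear_part g *m linear_part h,
   linear_part g *m translation_part h + translation_part g).
Proof.
rewrite /is_rigid /= trmx_mul mulmxA -(mulmxA _ (linear_part h)).
by rewrite linear_part_mulmxtr mulmx1 linear_part_mulmxtr.
Qed.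

Lemma rigid_one_subproof : is_rigid (1%:M, 0).
Proof. by rewrite /is_rigid /= trmx1 mulmx1. Qed.

Lemma rigid_inv_subproof g : is_rigid
  ((linear_part g)^T, - ((linear_part g)^T *m translation_part g)).
Proof. by rewrite /is_rigid /= trmxK linear_part_trmulmx. Qed.

Definition rigid_mul g h : rigid_motion := Sub _ (rigid_mul_subproof g h).
Definition rigid_one : rigid_motion := Sub _ rigid_one_subproof.
Definition rigid_inv g : rigid_motion := Sub _ (rigid_inv_subproof g).

Lemma rigid_mulA : associative rigid_mul.
Proof.
move=> f g h; apply: val_inj; congr pair; first by rewrite /= mulmxA.
by rewrite /= mulmxDr mulmxA addrA.
Qed.

Lemma rigid_mul1 : left_id rigid_one rigid_mul.
Proof.
by move=> g; apply: val_inj; rewrite /= !mul1mx addr0 -surjective_pairing.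
Qed.

Lemma rigid_mulr1 : right_id rigid_one rigid_mul.
Proof.
move=> g; apply: val_inj.
by rewrite /= mulmx1 mulmx0 add0r -surjective_pairing.
Qed.

Lemma rigid_mulV : left_inverse rigid_one rigid_inv rigid_mul.
Proof.
by move=> g; apply: val_inj; rewrite /= linear_part_trmulmx subrr.
Qed.

Lemma rigid_mulrV : right_inverse rigid_one rigid_inv rigid_mul.
Proof.
move=> g; apply: val_inj; rewrite /= linear_part_mulmxtr mulmxN mulmxA.
by rewrite linear_part_mulmxtr mul1mx addNr.
Qed.

HB.instance Definition _ := isGroup.Build rigid_motion
  rigid_mulA rigid_mul1 rigid_mulr1 rigid_mulV rigid_mulrV.

Lemma linear_partM g h :
  linear_part (g * h)%g = linear_part g *m linear_part h.
Proof. by []. Qed.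

Lemma linear_part1 : linear_part 1%g = 1%:M.
Proof. by []. Qed.

Lemma linear_partV g : linear_part g^-1%g = (linear_part g)^T.
Proof. by []. Qed.

End RigidMotions.

Section Bieberbach.
Variables (R : realType) (n : nat) (Gamma : groupClosed (rigid_motion R n)).

Definition discrete_subgroup :=
  forall U : set [set` Gamma], open U.

Definition cocompact_subgroup :=
  compact [set: quotient_topology (coset_space Gamma)].

Definition Bieberbach_group :=
  [/\ torsion_free (subgroup Gamma), discrete_subgroup & cocompact_subgroup].

Definition translation_subgroup : {pred subgroup Gamma} :=
  fun g => linear_part (val g) == 1%:M%R.

Lemma translation_subgroup_mulg_closed : mulg_closed translation_subgroup.
Proof.
by move=> g h /eqP g1 /eqP h1; apply/eqP; rewrite gmulfM linear_partM g1 h1 mulmx1.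
Qed.

Lemma translation_subgroup_1 : 1 \in translation_subgroup.
Proof. by apply/eqP; rewrite gmulf1 linear_part1. Qed.

Lemma translation_subgroup_invg_closed : invg_closed translation_subgroup.
Proof. by move=> g /eqP g1; apply/eqP; rewrite gmulfV linear_partV g1 trmx1. Qed.

HB.instance Definition _ := isMulClosed.Build (subgroup Gamma)
  translation_subgroup translation_subgroup_mulg_closed.
HB.instance Definition _ := isMul1Closed.Build (subgroup Gamma)
  translation_subgroup translation_subgroup_1.
HB.instance Definition _ := isInvClosed.Build (subgroup Gamma)
  translation_subgroup translation_subgroup_invg_closed.

Lemma translation_subgroup_conj g h :
  g \in translation_subgroup -> g ^ h \in translation_subgroup.
Proof.
move=> /eqP g1; apply/eqP; rewrite /conjg !gmulfM gmulfV !linear_partM g1 mul1mx.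
exact: linear_part_trmulmx.
Qed.

HB.instance Definition _ := isConjClosed.Build (subgroup Gamma)
  translation_subgroup translation_subgroup_conj.

Definition holonomy_group := quotient_group translation_subgroup.

HB.instance Definition _ := Group.on holonomy_group.

(* The group law of 'Z_2 is addition, and {ffun I -> G} is the direct power. *)
Definition GHW_group :=
  Bieberbach_group /\ isomorphic holonomy_group {ffun 'I_n.-1 -> 'Z_2}.

End Bieberbach.

(* Main.v *)
From mathcomp Require Import all_boot all_order all_algebra.
From mathcomp Require Import all_classical all_reals.
From mathcomp Require Import perm topology normedtype.
From mathcomp Require Import zify ring lra.
Require Import Defs.

Set Implicit Arguments.
Unset Strict Implicit.
Unset Printing Implicit Defensive.

Import Order.TTheory GRing.Theory Num.Theory.
Import numFieldNormedType.Exports.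

(** The linear parts of Gamma are commuting involutions, so they can be
diagonalised simultaneously. In a basis of common eigenvectors an element g of
Gamma is given by n signs chi g k and n real coordinates pos g k, and
the product is pos (g h) k = pos g k +- pos h k with the sign of g on the
k-th axis. The translations form the lattice Lambda on which all signs are +.

The set of sign vectors is a subgroup of (Z/2)^n of index 2. It does not contain
the all-minus vector, since an element with these signs squares to 1 and
Gamma is torsion-free. So of any sign vector and its negative exactly one
occurs. For a given axis k, Gamma thus contains either the reflection that
changes only the sign of axis k, or the rotation that changes all the other
signs. Everything else follows from this dichotomy:
- the n sign characters are pairwise distinct;
- each axis carries a rank one sublattice Z l_k of Lambda (axis_generator), and
  2 Lambda is contained in the sum of these;
- if Gamma contains the rotation about axis k, then Lambda projects onto axis k
  inside Z l_k, because otherwise some lift of the rotation would have order 2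
  (projection_int).

Lambda is the centralizer of the squares of Gamma, hence characteristic. An
automorphism phi permutes the characters and so maps each l_k to some
l_i or its inverse: it induces a signed permutation, one of 2^n n! possible ones
(aut_signed_perm). If phi and psi induce the same signed permutation, then
theta = psi^-1 phi fixes all the l_k, hence Lambda. Such a theta changes pos g k
only when g is negative on axis k, and then by an amount m_k l_k that does not
depend on g, with m_k an integer (shift_int). Conjugation by the translation
with coordinates r_k l_k shifts by 2 r_k l_k, so theta is determined up to
conjugation by Lambda by the parities of the m_k: there are at most 2^n classes.

Altogether Aut(Gamma), modulo conjugation by Lambda, embeds in a set of
2^n n! 2^n codes (aut_code). The group Inn(Gamma) modulo conjugation by Lambda
has 2^(n-1) elements, one for each element of the holonomy, which leaves
2^(n+1) n! for Out(Gamma). A nontrivial central element is a translation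
fixed by the holonomy, so it makes one character k trivial; then the
permutations fix k and the parity of m_k carries no information, so that only
(n-1)! 2^n 2^(n-1) codes remain. *)

(** * Counting *)

(** The division by #|E| happens after the finiteness of X is deduced from the
injectivity of c on a single slice. *)
Lemma card_le_code (X : Type) (E T : finType) (D : {set T}) (N : nat)
    (c : X -> E -> T) :
  (forall x y e f, c x e = c y f -> x = y /\ e = f) ->
  (forall x e, c x e \in D) -> (0 < #|E|)%N -> (#|D| <= N * #|E|)%N ->
  ([set: X]%classic #<= `I_N)%card.
Proof.
move=> c_inj cD E0 DN; have /card_gt0P[e0 _] := E0.
pose A := [set t : T | `[< exists x, c x e0 = t >]].
have Ac x : c x e0 \in A by rewrite inE; apply/asboolP; exists x.
have AN : (#|A| <= N)%N.
  have [[x0 _]|X0] := pselect (exists x0 : X, True); last first.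
    have -> : A = finset.set0.
      apply/finset.setP => t; rewrite !inE; apply/asboolP => -[x _].
      by apply: X0; exists x.
    by rewrite cards0.
  have /choice[r rP] : forall t, exists x, t \in A -> c x e0 = t.
    move=> t; case tA: (t \in A); last by exists x0.
    by move: tA; rewrite inE => /asboolP[x xt]; exists x.
  rewrite -(leq_pmul2r E0); apply: leq_trans DN.
  rewrite -cardsT -cardsX -(card_in_imset (f := fun p => c (r p.1) p.2)).
    by apply/subset_leq_card/fintype.subsetP => _ /imsetP[p _ ->].
  move=> [t e] [u f]; rewrite !inE !andbT /= => tA uA /c_inj[ru ->].
  have := rP t; rewrite inE tA => /(_ isT) <-; rewrite ru.
  by have := rP u; rewrite inE uA => /(_ isT) ->.
apply/pcard_leP/injfunPex; exists (fun x => index (c x e0) (enum A)).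
  by move=> x _ /=; apply: leq_trans AN; rewrite cardE index_mem mem_enum.
move=> x y _ _ xy; have mA z : c z e0 \in enum A by rewrite mem_enum.
by have /c_inj[] := index_inj (c x e0) (mA x) (mA y) xy.
Qed.

(** * Groups acting diagonally *)

(** The value true of chi g k is a minus sign. The family s picks one group
element for each element of the holonomy group. *)
Section DiagonalGroup.
Variables (R : realType) (n : nat) (G : groupType) (E : finType).
Variables (chi : G -> {ffun 'I_n -> bool}) (pos : G -> 'I_n -> R) (s : E -> G).

Local Open Scope ring_scope.
Local Notation sgn g k := ((-1) ^+ (chi g k : bool) : R).

Hypothesis n_gt0 : (0 < n)%N.
Hypothesis chiM : forall g h k, chi (g * h)%g k = chi g k (+) chi h k.
Hypothesis posM : forall g h k, pos (g * h)%g k = pos g k + sgn g k * pos h k.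
Hypothesis faithful : forall g, (forall k, chi g k = false) ->
  (forall k, pos g k = 0) -> g = 1%g.
Hypothesis tf : torsion_free G.
Hypothesis cardE : #|E| = (2 ^ n.-1)%N.
Hypothesis s_inj : forall e e', chi (s e) = chi (s e') -> e = e'.

Definition translation (g : G) : Prop := forall k, chi g k = false.

Hypothesis spanning :
  forall k, exists2 t, translation t & pos t k != 0.

Definition on_axis (k : 'I_n) (t : G) : Prop :=
  translation t /\ (forall i, i != k -> pos t i = 0).

Hypothesis discrete : forall k, exists2 eps : R, 0 < eps &
  forall t, on_axis k t -> `|pos t k| < eps -> pos t k = 0.

Lemma chi1 k : chi 1%g k = false.
Proof. by have := chiM 1%g 1%g k; rewrite mulg1; case: (chi 1%g k). Qed.

Lemma chiV g k : chi g^-1%g k = chi g k.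
Proof.
by have := chiM g g^-1%g k; rewrite mulgV chi1; do 2 case: (chi _ k).
Qed.

Lemma pos1 k : pos 1%g k = 0.
Proof. by have := posM 1%g 1%g k; rewrite mulg1 chi1 expr0 mul1r => h; lra. Qed.

Lemma posV g k : pos g^-1%g k = - (sgn g k * pos g k).
Proof.
have := posM g^-1%g g k; rewrite mulVg pos1 chiV => h; lra.
Qed.

Lemma faithful2 g h : chi g = chi h -> pos g =1 pos h -> g = h.
Proof.
move=> cE pE; apply/(mulIg h^-1%g); rewrite mulgV; apply: faithful => k.
  by rewrite chiM chiV cE addbb.
by rewrite posM posV pE cE mulrN mulrA -signr_addb addbb mul1r subrr.
Qed.

Lemma transl_chi t : translation t -> chi t = [ffun=> false].
Proof. by move=> ht; apply/ffunP => k; rewrite ffunE. Qed.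

Lemma transl1 : translation 1%g.
Proof. exact: chi1. Qed.

Lemma translM t u : translation t -> translation u -> translation (t * u)%g.
Proof. by move=> ht hu k; rewrite chiM ht hu. Qed.

Lemma translV t : translation t -> translation t^-1%g.
Proof. by move=> ht k; rewrite chiV. Qed.

Lemma translJ g t : translation t -> translation (g * t * g^-1)%g.
Proof. by move=> ht k; rewrite !chiM chiV ht addbF addbb. Qed.

Lemma transl_sqr g : translation (g * g)%g.
Proof. by move=> k; rewrite chiM addbb. Qed.

Lemma pos_translM t u k : translation t ->
  pos (t * u)%g k = pos t k + pos u k.
Proof. by move=> ht; rewrite posM ht mul1r. Qed.

Lemma pos_translV t k : translation t -> pos t^-1%g k = - pos t k.
Proof. by move=> ht; rewrite posV ht mul1r. Qed.

Lemma pos_translJ g t k : translation t ->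
  pos (g * t * g^-1)%g k = sgn g k * pos t k.
Proof.
move=> ht; rewrite !posM posV chiM ht addbF mulrN mulrA -signr_addb addbb.
by rewrite mul1r addrAC subrr add0r.
Qed.

Lemma pos_sqr g k : pos (g * g)%g k = if chi g k then 0 else 2 * pos g k.
Proof. by rewrite posM; case: (chi g k); rewrite ?expr1 ?expr0; lra. Qed.

Lemma transl_eq t u : translation t -> translation u -> pos t =1 pos u -> t = u.
Proof. by move=> ht hu; apply: faithful2; rewrite !transl_chi. Qed.

Lemma transl_comm t u : translation t -> translation u -> commute t u.
Proof.
move=> ht hu; apply: transl_eq => [||k]; [exact: translM|exact: translM|].
by rewrite !pos_translM // addrC.
Qed.

Lemma pos_translX t m k : translation t ->
  translation (t ^+ m)%g /\ pos (t ^+ m)%g k = m%:R * pos t k.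
Proof.
move=> ht; elim: m => [|m [IHt IHp]].
  by rewrite expg0 pos1 mul0r; split=> //; exact: transl1.
rewrite expgS; split; first exact: translM.
by rewrite pos_translM // IHp -natr1; lra.
Qed.

(** This describes translations in terms of the group structure alone, which is
why automorphisms preserve them. The squares contain the doubles of all
translations, so they span, and only translations can commute with them. *)
Lemma translE t :
  translation t <-> (forall g, commute t (g * g)%g).
Proof.
split=> [ht g|ht k]; first by apply: transl_comm => //; exact: transl_sqr.
have [u hu nz] := spanning k.
have := congr1 (fun x => pos x k) (ht u); rewrite !posM !chiM hu /=.
rewrite expr0 !mul1r; case: (chi t k) => //; rewrite expr1 => h.
by case/eqP: nz; lra.
Qed.

(** A motion with linear part -1 has a fixed point, so it would be an element of
order 2. *)
Lemma not_antipodal g : ~ (forall k, chi g k).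
Proof.
move=> hg; have g2 : (g * g)%g = 1%g.
  apply: faithful => k; first exact: transl_sqr.
  by rewrite pos_sqr hg.
have g1 : g = 1%g by apply: (@tf g 2) => //; rewrite expgS expg1.
by have := hg (Ordinal n_gt0); rewrite g1 chi1.
Qed.

(** The sign vectors that occur and their negatives are disjoint sets of 2^(n-1)
elements each, so together they exhaust the 2^n sign vectors. *)
Lemma mem_or_antipode (v : {ffun 'I_n -> bool}) :
  exists g, chi g = v \/ chi g = [ffun k => ~~ v k].
Proof.
pose neg (v : {ffun 'I_n -> bool}) := [ffun k => ~~ v k].
have negK : involutive neg by move=> w; apply/ffunP => k; rewrite !ffunE negbK.
pose H := [set chi (s e) | e : E].
have cH : #|H| = (2 ^ n.-1)%N.
  by rewrite card_imset ?cardE // => e e'; apply: s_inj.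
have : H :|: neg @: H = [set: {ffun 'I_n -> bool}].
  apply/eqP; rewrite eqEcard finset.subsetT finset.cardsT.
  rewrite card_ffun card_bool card_ord cardsU.
  rewrite card_imset ?cH; last exact: inv_inj negK.
  suff -> : H :&: neg @: H = finset.set0.
    by rewrite cards0 subn0 addnn -mul2n -expnS prednK //= leqnn.
  apply/finset.setP => w; rewrite !inE; apply/negP => /andP[/imsetP[e _ ->]].
  case/imsetP => _ /imsetP[e' _ ->] ee'; apply: (@not_antipodal (s e * s e')%g).
  by move=> k; rewrite chiM ee' ffunE; case: (chi _ k).
move/finset.setP => /(_ v); rewrite !inE => /orP[/imsetP[e _ ->]|].
  by exists (s e); left.
case/imsetP => _ /imsetP[e _ ->] ->; exists (s e); right.
by rewrite -[X in _ = X]/(neg (neg _)) negK.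
Qed.

Lemma reflection_or_rotation k :
  (exists g, forall i, chi g i = (i == k)) \/
  (exists g, forall i, chi g i = (i != k)).
Proof.
have [g []] := mem_or_antipode [ffun i => i == k] => /ffunP e; [left|right];
by exists g => i; rewrite e !ffunE.
Qed.

(** Both the reflection in axis i and the rotation about axis i tell axis i from
all the others. *)
Lemma chi_neq i j : (forall g, chi g i = chi g j) -> i = j.
Proof.
move=> h; apply/eqP; have [[g gE]|[g gE]] := reflection_or_rotation i.
  by have := h g; rewrite !gE eqxx eq_sym.
by have := h g; rewrite !gE eqxx eq_sym => /esym/negbFE.
Qed.

Lemma on_axis_eq k t u :
  on_axis k t -> on_axis k u -> pos t k = pos u k -> t = u.
Proof.
move=> [ht zt] [hu zu] e; apply: transl_eq => // i.
by have [->//|ik] := eqVneq i k; rewrite zt ?zu.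
Qed.

(** Twice the projection of a lattice vector to an axis is again a lattice
vector: it is t - g t for a reflection g in the axis, and t + g t for a rotation g
about it. The explicit formula is what makes it possible to follow the
projection through an automorphism. *)
Lemma double_on_axis k t : translation t -> exists g,
  if chi g k then on_axis k (t * (g * t * g^-1)^-1)%g
  else on_axis k (t * (g * t * g^-1))%g.
Proof.
move=> ht; have htJ g := translJ g ht.
have [[g gE]|[g gE]] := reflection_or_rotation k; exists g;
  rewrite gE eqxx /=.
- split=> [|i /negPf ik]; first by apply: translM => //; apply: translV.
  rewrite pos_translM // pos_translV // pos_translJ // gE ik expr0; lra.
- split=> [|i ik]; first by apply: translM.
  by rewrite pos_translM // pos_translJ // gE ik expr1; lra.
Qed.

Lemma double_on_axis_pos k t : translation t ->
  exists2 u, on_axis k u & pos u k = 2 * pos t k.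
Proof.
move=> ht; have [g] := double_on_axis k ht.
case cg: (chi g k) => h; [exists (t * (g * t * g^-1)^-1)%g|
  exists (t * (g * t * g^-1))%g] => //.
  rewrite pos_translM // pos_translV ?pos_translJ //; last exact: translJ.
  by rewrite cg expr1; lra.
by rewrite pos_translM // pos_translJ // cg expr0; lra.
Qed.

Lemma on_axis1 k : on_axis k 1%g.
Proof. by split=> *; [exact: transl1|rewrite pos1]. Qed.

Lemma on_axisM k t u : on_axis k t -> on_axis k u -> on_axis k (t * u)%g.
Proof.
move=> [ht zt] [hu zu]; split=> [|i ik]; first exact: translM.
by rewrite pos_translM // zt // zu // addr0.
Qed.

Lemma on_axisV k t : on_axis k t -> on_axis k t^-1%g.
Proof.
move=> [ht zt]; split=> [|i ik]; first exact: translV.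
by rewrite pos_translV // zt // oppr0.
Qed.

Lemma on_axisZ k t (m : int) : on_axis k t ->
  exists2 u, on_axis k u & pos u k = m%:~R * pos t k.
Proof.
move=> kt; have X j : on_axis k (t ^+ j)%g.
  elim: j => [|j IH]; first by rewrite expg0; exact: on_axis1.
  by rewrite expgS; exact: on_axisM.
case: m => j.
  by exists (t ^+ j)%g => //; rewrite (pos_translX _ _ kt.1).2.
exists (t ^+ j.+1)^-1%g; first exact: on_axisV.
rewrite pos_translV; last exact: (X _).1.
by rewrite (pos_translX _ _ kt.1).2 NegzE mulrNz mulNr.
Qed.

(** A nonzero discrete subgroup of the line is generated by its least positive
element. *)
Lemma axis_generator k : exists l,
  [/\ on_axis k l, 0 < pos l k &
      forall t, on_axis k t -> exists m : int, pos t k = m%:~R * pos l k].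
Proof.
have [eps eps0 heps] := discrete k.
(* The least positive element is reached by minimising the integer part of
   pos t k / eps: two positive elements with the same integer part differ
   by less than eps, hence are equal. *)
pose P (j : nat) := `[< exists t, [/\ on_axis k t, 0 < pos t k &
  Num.truncn (pos t k / eps) = j] >].
have exP : exists j, P j.
  have [t0 ht0 nz] := spanning k.
  have [u ku uE] := double_on_axis_pos k ht0; have hu := ku.1.
  have nzu : pos u k != 0 by rewrite uE mulf_neq0 // pnatr_eq0.
  have : exists2 v, on_axis k v & 0 < pos v k.
    have [p|p] := ltP 0 (pos u k); first by exists u.
    exists u^-1%g; first exact: on_axisV.
    by rewrite pos_translV // oppr_gt0 lt_neqAle nzu.
  case=> v kv v0; exists (Num.truncn (pos v k / eps)).
  by apply/asboolP; exists v.
case: (ex_minnP exP) => j /asboolP[l [kl l0 lj]] jmin.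
exists l; split=> // t kt.
have hl := kl.1; have ht := kt.1.
pose m := Num.floor (pos t k / pos l k); exists m.
have [u ku uE] := on_axisZ (- m) kl.
have ktu := on_axisM kt ku; have htu := ktu.1.
have rE : pos (t * u)%g k = pos t k - m%:~R * pos l k.
  by rewrite pos_translM // uE mulrNz mulNr.
have /andP[m1 m2] : m%:~R <= pos t k / pos l k < (m + 1)%:~R.
  exact: floor_itv.
rewrite ler_pdivlMr // in m1; rewrite ltr_pdivrMr // intrD mulrDl mul1r in m2.
have r0 : 0 <= pos (t * u)%g k by rewrite rE; lra.
have rl : pos (t * u)%g k < pos l k by rewrite rE; lra.
suff : pos (t * u)%g k = 0 by rewrite rE => h; lra.
move: r0; rewrite le_eqVlt => /orP[/eqP->//|r0].
have /jmin jr : P (Num.truncn (pos (t * u)%g k / eps)).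
  by apply/asboolP; exists (t * u)%g.
have /andP[a1 a2] : (Num.truncn (pos (t * u)%g k / eps))%:R
    <= pos (t * u)%g k / eps < (Num.truncn (pos (t * u)%g k / eps)).+1%:R.
  by apply: truncn_itv; rewrite divr_ge0 // ltW.
have /andP[b1 b2] : j%:R <= pos l k / eps < j.+1%:R.
  by rewrite -lj; apply: truncn_itv; rewrite divr_ge0 // ltW.
rewrite ltr_pdivrMr // in b2; rewrite ler_pdivlMr // in a1.
have jr' : j%:R * eps <= (Num.truncn (pos (t * u)%g k / eps))%:R * eps.
  by rewrite ler_pM2r // ler_nat.
have : pos (l * (t * u)^-1)%g k = 0.
  apply: heps; first exact/on_axisM/on_axisV.
  rewrite pos_translM // pos_translV // ger0_norm; last lra.
  by move: b2; rewrite -natr1 mulrDl mul1r; lra.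
by rewrite pos_translM // pos_translV // => h; exfalso; lra.
Qed.


(** * The axis lattices *)

Definition gen k : G := projT1 (cid (axis_generator k)).

Lemma genP k : [/\ on_axis k (gen k), 0 < pos (gen k) k &
  forall t, on_axis k t -> exists m : int, pos t k = m%:~R * pos (gen k) k].
Proof. exact: projT2 (cid (axis_generator k)). Qed.

Lemma gen_axis k : on_axis k (gen k). Proof. by case: (genP k). Qed.
Lemma gen_transl k : translation (gen k). Proof. exact: (gen_axis k).1. Qed.
Lemma gen_gt0 k : 0 < pos (gen k) k. Proof. by case: (genP k). Qed.
Lemma gen_int k t : on_axis k t ->
  exists m : int, pos t k = m%:~R * pos (gen k) k.
Proof. by case: (genP k) => _ _; apply. Qed.

Lemma transl_comb (r : 'I_n -> int) : exists2 t, translation t &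
  forall k, pos t k = (r k)%:~R * pos (gen k) k.
Proof.
suff [t ht tE] : exists2 t, translation t & forall k,
    pos t k = if k \in enum 'I_n then (r k)%:~R * pos (gen k) k else 0.
  by exists t => // k; rewrite tE mem_enum.
elim: (enum 'I_n) (enum_uniq 'I_n) => [_|i e IH /= /andP[ie /IH[t ht tE]]].
  by exists 1%g => [|k]; [exact: transl1|rewrite pos1].
have [u [hu zu] uE] := on_axisZ (r i) (gen_axis i).
exists (u * t)%g => [|k]; first exact: translM.
rewrite pos_translM // tE inE; have [->|ki] := eqVneq k i.
  by rewrite (negPf ie) addr0 uE.
by rewrite zu // add0r.
Qed.

(** The square of g is a translation along axis k, say by m l_k, and the squares
of the elements t g with t in Lambda are the translations by m l_k + 2 p_k(t)
along axis k, where p_k is the projection. The numbers 2 p_k(t) form a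
subgroup of Z l_k which contains 2 l_k. If it also contained an odd multiple
of l_k, then it would contain - m l_k, and some t g would be an element of
order 2. *)
Lemma projection_int k g : (forall i, chi g i = (i != k)) ->
  forall t, translation t -> exists m : int, pos t k = m%:~R * pos (gen k) k.
Proof.
move=> gE t ht; have gen0 := gen_gt0 k.
have [all_k|/existsP[i0 i0k]] := boolP [forall i, i == k].
  by apply: gen_int; split=> // i; rewrite (forallP all_k i).
have ggk : on_axis k (g * g)%g.
  by split=> [|i ik]; [exact: transl_sqr|rewrite pos_sqr gE ik].
have [m mE] := gen_int ggk; rewrite pos_sqr gE eqxx /= in mE.
have [u ku uE] := double_on_axis_pos k ht.
have [j jE] := gen_int ku; rewrite uE in jE.
(* Such a u' would make u' * g an involution, although u' * g is nontrivial
   because it is negative on axis i0. *)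
have no_root u' : translation u' -> 2 * pos u' k <> - m%:~R * pos (gen k) k.
  move=> hu' u'E; have : (u' * g = 1)%g.
    apply: (@tf _ 2) => //; rewrite expgS expg1.
    have chiu i : chi (u' * g)%g i = (i != k) by rewrite chiM hu' gE.
    apply: faithful => [|i]; first exact: transl_sqr.
    rewrite pos_sqr chiu; have [->|//] := eqVneq i k.
    by rewrite /= pos_translM //; lra.
  move=> /(congr1 (fun x => chi x i0)).
  by rewrite chiM hu' gE i0k chi1.
have parity (z : int) : exists q : int, z = 2 * q \/ z = 2 * q + 1.
  exists (z %/ 2)%Z; have := divz_eq z 2.
  have := modz_ge0 z (isT : 2 != 0 :> int).
  by have := ltz_mod z (isT : 2 != 0 :> int); move: (z %% 2)%Z => w; lia.
have [q [qE|qE]] := parity j.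
  by exists q; rewrite qE intrM in jE; lra.
have [p [pE|pE]] := parity m; exfalso.
  have [v [hv _] vE] := on_axisZ (- p) (gen_axis k).
  by apply: (no_root v hv); rewrite vE pE intrM mulrNz; lra.
have [v [hv _] vE] := on_axisZ (- p - 1 - q) (gen_axis k).
apply: (no_root (v * t)%g); first exact: translM.
rewrite pos_translM // vE; move: jE.
by rewrite qE pE !(intrD, intrM, mulrNz); lra.
Qed.

(** * Automorphisms as signed permutations *)

Implicit Types phi psi : automorphism_group G.

Lemma aut1 phi : val phi 1%g = 1%g.
Proof. by apply: (mulgI (val phi 1%g)); rewrite -autM !mulg1. Qed.

Lemma autV phi g : val phi g^-1%g = (val phi g)^-1%g.
Proof. by apply: (mulgI (val phi g)); rewrite -autM !mulgV aut1. Qed.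

Lemma autX phi g m : val phi (g ^+ m)%g = (val phi g ^+ m)%g.
Proof. by elim: m => [|m IH]; rewrite ?expg0 ?aut1 // !expgS autM IH. Qed.

Lemma autJ phi g t : val phi (g * t * g^-1)%g =
  (val phi g * val phi t * (val phi g)^-1)%g.
Proof. by rewrite !autM autV. Qed.

Lemma aut_surj phi g : exists h, val phi h = g.
Proof. by have [f _ fK] := aut_bij phi; exists (f g). Qed.

Lemma aut_transl phi t : translation t -> translation (val phi t).
Proof.
move=> /translE ht; apply/translE => g; have [h <-] := aut_surj phi g.
by rewrite -autM /commute -!autM ht.
Qed.

(** An automorphism is additive on translations, hence Z-linear. *)
Lemma pos_aut_int phi t u i (m : int) : translation t -> translation u ->
  (forall k, pos t k = m%:~R * pos u k) ->
  pos (val phi t) i = m%:~R * pos (val phi u) i.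
Proof.
move=> ht hu tE; have hpu := aut_transl phi hu.
case: m tE => m tE.
  have -> : t = (u ^+ m)%g.
    apply: transl_eq => // [|k]; first exact: (pos_translX m i hu).1.
    by rewrite (pos_translX m k hu).2 tE.
  by rewrite autX (pos_translX m i hpu).2.
have -> : t = (u ^+ m.+1)^-1%g.
  have hX k := pos_translX m.+1 k hu.
  apply: transl_eq => // [|k]; first exact/translV/(hX i).1.
  rewrite pos_translV ?(hX k).2 ?tE; last exact: (hX i).1.
  by rewrite NegzE mulrNz mulNr.
have hX := pos_translX m.+1 i hpu.
rewrite autV autX pos_translV; last exact: hX.1.
by rewrite hX.2 NegzE mulrNz mulNr.
Qed.

Lemma pos_autJ_axis phi k u g i : on_axis k u ->
  pos (val phi (g * u * g^-1)%g) i = sgn g k * pos (val phi u) i.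
Proof.
move=> [hu zu]; rewrite (@pos_aut_int phi _ u i ((-1) ^+ (chi g k : bool))) //.
- by rewrite rmorphXn /= rmorphN1.
- exact: translJ.
- move=> j; rewrite pos_translJ // rmorphXn /= rmorphN1.
  by have [->//|jk] := eqVneq j k; rewrite zu // !mulr0.
Qed.

(** Conjugation by g multiplies the generator by its sign chi g k, so
conjugation by phi g multiplies the image of the generator by this sign. Each axis on
which the image has a nonzero coordinate therefore carries the character that
chi _ k becomes under phi, and there is only one such axis. *)
Lemma aut_gen_axis phi k : exists2 i, on_axis i (val phi (gen k)) &
  forall g, chi (val phi g) i = chi g k.
Proof.
have [hl zl] := gen_axis k; have hpl := aut_transl phi hl.
have chiE i : pos (val phi (gen k)) i != 0 ->
    forall g, chi (val phi g) i = chi g k.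
  move=> nz g; have := pos_translJ (val phi g) i hpl.
  rewrite -autJ (pos_autJ_axis phi g i (gen_axis k)) => /(mulIf nz).
  by move/signr_inj.
have [/existsP[i nz]|/existsPn z] :=
  boolP [exists i, pos (val phi (gen k)) i != 0].
  exists i; last exact: chiE.
  split=> // j ji; apply/eqP; apply/negPn/negP => nzj; case/eqP: ji.
  apply: chi_neq => g; have [h <-] := aut_surj phi g.
  by rewrite (chiE _ nzj) (chiE _ nz).
have p1 : val phi (gen k) = val phi 1%g.
  by rewrite aut1; apply: faithful => // i; apply/eqP; rewrite -[_ == _]negbK z.
have := gen_gt0 k; rewrite (bij_inj (aut_bij phi) p1) pos1 ltxx //.
Qed.

(** Applied to the inverse automorphism, the previous lemma shows that the image
of the generator is a generator of the axis lattice in which it lies. *)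
Lemma aut_gen phi k : exists i (b : bool),
  [/\ on_axis i (val phi (gen k)), forall g, chi (val phi g) i = chi g k &
      pos (val phi (gen k)) i = (-1) ^+ b * pos (gen i) i].
Proof.
have [i ai ci] := aut_gen_axis phi k.
have [m mE] := gen_int ai.
pose psi := aut_inv phi; have psiK : cancel (val phi) (val psi) := aut_invK phi.
have [j aj cj] := aut_gen_axis psi i.
have jk : j = k by apply: chi_neq => g; rewrite -[g]psiK cj ci psiK.
rewrite {j}jk in aj cj.
have [m' m'E] := gen_int aj.
have zE : forall r, pos (val phi (gen k)) r = m%:~R * pos (gen i) r.
  move=> r; have [->//|ri] := eqVneq r i.
  by rewrite ai.2 // (gen_axis i).2 // mulr0.
have := pos_aut_int psi k ai.1 (gen_transl i) zE.
rewrite psiK m'E mulrA => /esym e.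
have : m * m' = 1.
  apply: (intr_inj (R := R)); rewrite intrM.
  by apply: (mulIf (lt0r_neq0 (gen_gt0 k))); rewrite e mul1r.
move=> mm; exists i.
have : m = 1 \/ m = -1.
  have := congr1 absz mm; rewrite abszM => /eqP.
  rewrite muln_eq1 => /andP[/eqP h _].
  by move: h; clear; case: m => [[|[|[]]]|[|[]]] //; [left|right].
by case=> e'; [exists false|exists true]; split=> //; rewrite mE e' ?rmorphN1.
Qed.

Lemma aut_signed_perm phi : exists (p : {perm 'I_n}) (b : {ffun 'I_n -> bool}),
  forall k, [/\ on_axis (p k) (val phi (gen k)),
    forall g, chi (val phi g) (p k) = chi g k &
    pos (val phi (gen k)) (p k) = (-1) ^+ (b k : bool) * pos (gen (p k)) (p k)].
Proof.
have [p /choice[b pbP]] := choice (aut_gen phi).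
have p_inj : injective p.
  move=> i j pij; apply: chi_neq => g.
  by have [_ <- _] := pbP i; have [_ <- _] := pbP j; rewrite pij.
exists (perm p_inj), (finfun b) => k; rewrite permE ffunE; exact: pbP.
Qed.

(** * Automorphisms that fix the lattice *)

Section GeneratorFixing.
Variable theta : automorphism_group G.
Hypothesis theta_gen : forall k, val theta (gen k) = gen k.

Lemma fix_chi g : chi (val theta g) = chi g.
Proof.
apply/ffunP => k; have := pos_translJ (val theta g) k (gen_transl k).
rewrite -{1}theta_gen -autJ (pos_autJ_axis theta g k (gen_axis k)) theta_gen.
by move/(mulIf (lt0r_neq0 (gen_gt0 k)))/signr_inj.
Qed.

Lemma fix_axis k t : on_axis k t -> pos (val theta t) k = pos t k.
Proof.
move=> kt; have [m mE] := gen_int kt; have hl := gen_axis k.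
rewrite (@pos_aut_int theta t (gen k) k m) ?theta_gen //; first exact: kt.1.
  exact: hl.1.
by move=> r; have [->//|rk] := eqVneq r k; rewrite kt.2 // hl.2 // mulr0.
Qed.

(** Lambda may be larger than the sum of the axis lattices, which only has to
contain 2 Lambda; this is enough since coordinates can be halved. *)
Lemma fix_transl t : translation t -> val theta t = t.
Proof.
move=> ht; have hpt := aut_transl theta ht.
have minus u h k : translation u ->
    pos (u * (h * u * h^-1)^-1)%g k = pos u k - sgn h k * pos u k.
  move=> hu; have hJ := translJ h hu.
  by rewrite pos_translM ?pos_translV ?pos_translJ.
have plus u h k : translation u ->
    pos (u * (h * u * h^-1))%g k = pos u k + sgn h k * pos u k.
  by move=> hu; rewrite pos_translM ?pos_translJ.
apply: transl_eq => // k; have [g] := double_on_axis k ht.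
case cg: (chi g k) => /fix_axis; rewrite autM ?autV autJ.
  by rewrite !minus // fix_chi cg expr1 => h; lra.
by rewrite !plus // fix_chi cg expr0 => h; lra.
Qed.

(** The translation theta g * g^-1, in coordinates; as a function of g it is a
1-cocycle with values in Lambda. *)
Definition shift g k := pos (val theta g) k - pos g k.

Definition shift_coefs (m : 'I_n -> int) : Prop := forall g k,
  shift g k = if chi g k then (m k)%:~R * pos (gen k) k else 0.

Lemma shiftM g h k : shift (g * h)%g k = shift g k + sgn g k * shift h k.
Proof. by rewrite /shift autM !posM fix_chi; ring. Qed.

Lemma shift_plus g k : chi g k = false -> shift g k = 0.
Proof.
move=> cg; have := shiftM g g k; rewrite cg expr0 {1}/shift.
by rewrite (fix_transl (transl_sqr g)); lra.
Qed.

Lemma shift_minus g h k : chi g k -> chi h k -> shift g k = shift h k.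
Proof.
move=> cg ch; have cgh : chi (g * h^-1)%g k = false by rewrite chiM chiV cg ch.
have := shiftM (g * h^-1)%g h k.
by rewrite mulgVK cgh (shift_plus cgh) => ->; lra.
Qed.

(** For a rotation about axis k, the projection of any translation is an
integral multiple of l_k. For a reflection h in axis k, the cocycle at h vanishes on
the other axes, so it is itself a translation along axis k. *)
Lemma shift_int g k : chi g k ->
  exists m : int, shift g k = m%:~R * pos (gen k) k.
Proof.
move=> cg; pose d h := (val theta h * h^-1)%g.
have dt h : translation (d h) by move=> i; rewrite chiM chiV fix_chi addbb.
have dE h i : pos (d h) i = shift h i.
  by rewrite posM posV fix_chi mulrN mulrA -signr_addb addbb mul1r.
rewrite -dE; have [[h hE]|[h hE]] := reflection_or_rotation k; last first.
  exact: projection_int hE _ (dt g).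
rewrite dE (@shift_minus g h) ?hE // -dE; apply: gen_int; split=> // i ik.
by rewrite dE shift_plus // hE (negPf ik).
Qed.

Lemma shift_coefs_exist : exists2 m, shift_coefs m &
  forall k, (forall g, chi g k = false) -> m k = 0.
Proof.
suff /choice[m mE] : forall k, exists m : int,
    (forall g, shift g k = if chi g k then m%:~R * pos (gen k) k else 0) /\
    ((forall g, chi g k = false) -> m = 0).
  by exists m => [g k|k]; [exact: (mE k).1|exact: (mE k).2].
move=> k; have [[h ch]|nh] := pselect (exists h, chi h k); last first.
  (* If the k-th character is trivial then the shift vanishes, and the
     coefficient is set to 0. *)
  have ck g : chi g k = false by apply/negP => cg; apply: nh; exists g.
  by exists 0; split=> // g; rewrite ck shift_plus.
have [m mE] := shift_int ch; exists m; split=> [g|/(_ h)]; last by rewrite ch.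
case cg: (chi g k); last exact: shift_plus.
by rewrite (shift_minus cg ch).
Qed.

End GeneratorFixing.

(** Conjugation by a translation t changes the k-th coordinate of g by 2 t_k if
g is negative on axis k and not at all otherwise; so t is half of the difference
of the two shifts. *)
Lemma even_shift_conj theta theta' (m m' : 'I_n -> int) :
  (forall k, val theta (gen k) = gen k) ->
  (forall k, val theta' (gen k) = gen k) ->
  shift_coefs theta m -> shift_coefs theta' m' ->
  (forall k, odd `|m k| = odd `|m' k|) ->
  exists2 t, translation t &
    forall g, val theta g = (t * val theta' g * t^-1)%g.
Proof.
move=> fx fx' sE sE' par.
have /choice[r rE] : forall k, exists r : int, m k - m' k = 2 * r.
  by move=> k; exists ((m k - m' k) %/ 2)%Z; have := par k; lia.
have [t ht tE] := transl_comb r; exists t => // g.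
apply: faithful2 => [|k].
  by apply/ffunP => k; rewrite !chiM chiV !ht addFb addbF fix_chi // fix_chi.
rewrite !posM !posV !chiM !ht addFb fix_chi // !expr0 !mul1r.
have := sE g k; have := sE' g k; rewrite /shift tE.
have /(congr1 (intr : int -> R)) := rE k; rewrite intrD intrM mulrNz.
move: (pos (gen k) k) => f; case: (chi g k); rewrite ?expr1 ?expr0 => e1 e2 e3.
  have -> : pos (val theta g) k = (m k)%:~R * f + pos g k by lra.
  have -> : pos (val theta' g) k = (m' k)%:~R * f + pos g k by lra.
  have -> : (m k)%:~R = 2 * (r k)%:~R + (m' k)%:~R :> R by lra.
  ring.
have -> : pos (val theta' g) k = pos g k by lra.
lra.
Qed.

(** The code of an automorphism consists of its signed permutation and of the
parities of the shift of its quotient by a base automorphism, chosen once for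
each signed permutation. *)
Lemma aut_code : exists c : automorphism_group G ->
    {perm 'I_n} * {ffun 'I_n -> bool} * {ffun 'I_n -> bool},
  (forall phi psi, c phi = c psi -> exists2 t, translation t &
     forall g, val phi g = (t * val psi g * t^-1)%g) /\
  (forall k, (forall g, chi g k = false) -> forall phi,
     (c phi).1.1 k = k /\ (c phi).2 k = false).
Proof.
have /choice[w wP] : forall phi, exists w : {perm 'I_n} * {ffun 'I_n -> bool},
    forall k, [/\ on_axis (w.1 k) (val phi (gen k)),
    forall g, chi (val phi g) (w.1 k) = chi g k &
    pos (val phi (gen k)) (w.1 k) =
      (-1) ^+ (w.2 k : bool) * pos (gen (w.1 k)) (w.1 k)].
  by move=> phi; have [p [b h]] := aut_signed_perm phi; exists (p, b).
have w_eq phi psi : w phi = w psi ->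
    forall k, val phi (gen k) = val psi (gen k).
  move=> e k; have [a _ x] := wP phi k; have [b _ y] := wP psi k.
  by rewrite e in a x; apply: (on_axis_eq a b); rewrite x y.
have /choice[base baseP] : forall v, exists psi,
    (exists phi, w phi = v) -> w psi = v.
  move=> v; have [[phi <-]|nv] := pselect (exists phi, w phi = v).
    by exists phi.
  by exists 1%g => /nv.
have {}baseP phi : w (base (w phi)) = w phi by apply: baseP; exists phi.
pose th phi : automorphism_group G := (aut_inv (base (w phi)) * phi)%g.
have thE phi g : val phi g = val (base (w phi)) (val (th phi) g).
  rewrite /th /=; have [f fK gK] := aut_bij (base (w phi)).
  by rewrite -[val phi g]gK aut_invK.
have th_fix phi k : val (th phi) (gen k) = gen k.
  rewrite /th /=; have <- := w_eq _ _ (baseP phi) k; exact: aut_invK.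
have /choice[m mP] : forall phi, exists m, shift_coefs (th phi) m /\
    (forall k, (forall g, chi g k = false) -> m k = 0).
  by move=> phi; have [m] := shift_coefs_exist (th_fix phi); exists m.
exists (fun phi => (w phi, [ffun k => odd `|m phi k|%N])); split.
  move=> phi psi [we /ffunP me]; have [||||k|t ht tE] :=
    @even_shift_conj (th phi) (th psi) (m phi) (m psi).
  - exact: th_fix.
  - exact: th_fix.
  - exact: (mP phi).1.
  - exact: (mP psi).1.
  - by have := me k; rewrite !ffunE.
  exists (val (base (w phi)) t); first exact: aut_transl.
  by move=> g; rewrite thE tE autJ (thE psi) we.
move=> k triv phi; rewrite ffunE (mP phi).2 //; split=> //=.
apply: chi_neq => g; have [h <-] := aut_surj phi g.
by have [_ -> _] := wP phi k; rewrite !triv.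
Qed.

(** * Outer automorphisms *)

Lemma conj_aut_subproof (a : G) : is_automorphism (fun x => a * x * a^-1)%g.
Proof.
apply/asboolP; split=> [x y|]; first by rewrite !mulgA mulgVK.
by exists (fun x => a^-1 * x * a)%g => x;
  rewrite !mulgA ?mulVg ?mulgV mul1g ?mulgK ?mulgVK.
Qed.

Definition conj_aut (a : G) : automorphism_group G :=
  Sub _ (conj_aut_subproof a).

Lemma conj_aut_inner a : conj_aut a \in @inner_automorphism G.
Proof. by apply/inner_automorphismP; exists a. Qed.

(** Representatives of the automorphisms modulo conjugation by Lambda, indexed
by Out G and the holonomy. *)
Definition twist (o : Out G) (e : E) : automorphism_group G :=
  (repr o * conj_aut (s e))%g.

Lemma pi_eq_inner phi psi (a : G) :
  (forall g, val phi g = (a * val psi g * a^-1)%g) ->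
  \pi_(Out G)%qT phi = \pi_(Out G)%qT psi.
Proof.
move=> h; apply/esym/pi_quotient_eqP.
have -> : (psi^-1 * phi = conj_aut a ^ psi)%g.
  rewrite /conjg; congr (_ * _)%g; apply: val_inj; apply/funext => g /=.
  exact: h.
exact/gpredJr/conj_aut_inner.
Qed.

Lemma pi_twist o e : \pi_(Out G)%qT (twist o e) = o.
Proof.
rewrite -[RHS]reprK; apply/esym/pi_quotient_eqP.
by rewrite /twist mulgA mulVg mul1g conj_aut_inner.
Qed.

(** Equal outer classes have the same chosen representative, so the two inner
factors differ by a translation; they then act by the same signs on the
generators. *)
Lemma twist_inj o o' e e' t : translation t ->
  (forall g, val (twist o e) g = (t * val (twist o' e') g * t^-1)%g) ->
  o = o' /\ e = e'.
Proof.
move=> ht h; have eo : o = o'.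
  by rewrite -(pi_twist o e) -(pi_twist o' e') (pi_eq_inner h).
split=> //; apply: s_inj; apply/ffunP => k.
have [t' ht'] : exists2 t', translation t' & t = val (repr o) t'.
  have [t' t'E] := aut_surj (repr o) t; exists t' => //.
  have := aut_transl (aut_inv (repr o)) ht; rewrite -t'E.
  by rewrite (aut_invK (repr o) t').
move: h; rewrite -{}eo => h tE.
have {}h g : (s e * g * (s e)^-1 = t' * (s e' * g * (s e')^-1) * t'^-1)%g.
  by apply: (bij_inj (aut_bij (repr o))); rewrite [RHS]autJ -tE; exact: h.
have := congr1 (fun x => pos x k) (h (gen k)).
rewrite pos_translJ; last exact: gen_transl.
rewrite pos_translJ; last by apply: translJ; exact: gen_transl.
rewrite ht' expr0 mul1r pos_translJ; last exact: gen_transl.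
by move/(mulIf (lt0r_neq0 (gen_gt0 k)))/signr_inj.
Qed.

Lemma card_E_gt0 : (0 < #|E|)%N. Proof. by rewrite cardE expn_gt0. Qed.

Lemma card_Out_le : ([set: Out G]%classic #<= `I_(2 ^ n.+1 * n`!))%card.
Proof.
have [c [c_inj _]] := aut_code.
apply: (@card_le_code _ _ _ [set: _] _ (fun o e => c (twist o e))).
- by move=> o o' e e' /c_inj[t ht]; exact: twist_inj.
- by move=> o e; rewrite finset.in_setT.
- exact: card_E_gt0.
rewrite finset.cardsT !card_prod card_Sn !card_ffun card_bool card_ord cardE.
have e2 : (2 ^ n = 2 * 2 ^ n.-1)%N by rewrite -expnS prednK.
by rewrite expnS e2 mulnC; nia.
Qed.

(** A central element commutes with the squares, so it is a translation; it is
invariant under conjugation, so every axis on which it has a nonzero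
coordinate has a trivial character. *)
Lemma trivial_character_of_center :
  center G <> [set 1%g]%classic -> exists k, forall g, chi g k = false.
Proof.
move=> Z1; apply: contrapT => no; apply: Z1.
apply/seteqP; split=> [z zZ|_ -> g]; last by rewrite /commute mulg1 mul1g.
have hz : translation z by apply/translE => g; exact: zZ.
apply: faithful => // k; have [//|nz] := eqVneq (pos z k) 0.
case: no; exists k => g; have := pos_translJ g k hz.
have -> : (g * z * g^-1 = z)%g by rewrite -(zZ g) mulgK.
by case: (chi g k) => //; rewrite expr1 => h; case/eqP: nz; lra.
Qed.

Lemma card_Out_le_center : center G <> [set 1%g]%classic ->
  ([set: Out G]%classic #<= `I_(2 ^ n * n.-1`!))%card.
Proof.
move=> /trivial_character_of_center[k0 k0P].
have [c [c_inj c_triv]] := aut_code.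
pose D : {set {perm 'I_n} * {ffun 'I_n -> bool} * {ffun 'I_n -> bool}} :=
  finset.setX (finset.setX [set p | perm_on [set~ k0] p]%SET finset.setT)
    [set b in pffun_on false [set~ k0] predT]%SET.
apply: (@card_le_code _ _ _ D _ (fun o e => c (twist o e))).
- by move=> o o' e e' /c_inj[t ht]; exact: twist_inj.
- move=> o e; have [pk bk] := c_triv k0 k0P (twist o e).
  rewrite !inE andbT; apply/andP; split.
    apply/fintype.subsetP => k; rewrite !inE.
    by apply: contraNN => /eqP->; rewrite pk.
  apply/pffun_onP; split=> //; apply/fintype.subsetP => k; rewrite !inE.
  by apply: contraNN => /eqP->; rewrite bk.
- exact: card_E_gt0.
have c0 : #|[set~ k0]| = n.-1 by rewrite cardsC1 card_ord.
rewrite !finset.cardsX finset.cardsT card_ffun card_bool card_ord !cardsE.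
rewrite card_perm card_pffun_on c0 cardE.
rewrite (_ : #|predT| = 2)%N ?[((n.-1)`! * _)%N]mulnC //= -card_bool.
exact: eq_card.
Qed.

End DiagonalGroup.

(** * Simultaneous diagonalisation of the holonomy *)

Section Holonomy.
Local Open Scope ring_scope.

Lemma involution_diagonalizable (F : fieldType) n (A : 'M[F]_n) :
  (2%:R != 0 :> F)%R -> (A *m A = 1%:M)%R -> diagonalizable A.
Proof.
case: n A => [|n] A nz2 A2.
  by exists 1%:M%R; [exact: unitmx1|apply/is_diag_mxP; case].
apply/diagonalizableP; exists [:: 1%R; (-1)%R].
  rewrite /= inE andbT; apply: contraNneq nz2 => e.
  by rewrite -[2%:R]/(1 + 1)%R {2}e subrr.
rewrite !big_cons big_nil mulr1; apply: mxminpoly_min.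
rewrite rmorphM /= !rmorphB /= horner_mx_X !horner_mx_C.
rewrite rmorphN1 opprK mulrDr mulr1 mulrBl mul1r.
by rewrite -[(A * A)%R]/(A *m A)%R A2 addrA subrK subrr.
Qed.

Variables (R : realType) (n : nat) (Gamma : groupClosed (rigid_motion R n)).
Local Notation G := (subgroup Gamma).
Local Notation L g := (linear_part (val (g : G))).
Variable f : {multiplicative holonomy_group Gamma -> {ffun 'I_n.-1 -> 'Z_2}}.
Hypothesis f_bij : bijective f.

Lemma holonomyM (g h : G) : L (g * h)%g = L g *m L h.
Proof. by rewrite gmulfM. Qed.

Lemma holonomyV (g : G) : L g^-1%g = (L g)^T.
Proof. by rewrite gmulfV. Qed.

Lemma pi_holonomy (g h : G) :
  \pi_(holonomy_group Gamma)%qT g = \pi_(holonomy_group Gamma)%qT h <->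
  L g = L h.
Proof.
have memE : (g^-1 * h \in @translation_subgroup R n Gamma)%g =
  (L (g^-1 * h)%g == 1%:M) by [].
split=> [/pi_quotient_eqP|e].
  rewrite memE holonomyM holonomyV => /eqP e.
  by rewrite -[RHS]mul1mx -(linear_part_mulmxtr (val g)) -mulmxA e mulmx1.
apply/pi_quotient_eqP; rewrite memE holonomyM holonomyV e.
exact/eqP/linear_part_trmulmx.
Qed.

Lemma pi_holonomyM (g h : G) : \pi_(holonomy_group Gamma)%qT (g * h)%g =
  (\pi_(holonomy_group Gamma)%qT g * \pi_(holonomy_group Gamma)%qT h)%g.
Proof. exact: pi_quotient_mul. Qed.

Lemma linear_part_comm (g h : G) : L g *m L h = L h *m L g.
Proof.
rewrite -!holonomyM; apply/pi_holonomy/(bij_inj f_bij).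
rewrite !pi_holonomyM !gmulfM; apply/ffunP => i; rewrite !ffunE.
exact: (@addrC 'Z_2).
Qed.

Lemma linear_part_sqr (g : G) : L g *m L g = 1%:M.
Proof.
have <- : L (1%g : G) = 1%:M by rewrite gmulf1.
rewrite -holonomyM; apply/pi_holonomy/(bij_inj f_bij).
have -> : f (\pi_(holonomy_group Gamma)%qT (1%g : G)) = 1%g.
  apply: (mulgI (f (\pi_(holonomy_group Gamma)%qT (1%g : G)))).
  by rewrite -gmulfM -pi_holonomyM !mulg1.
rewrite pi_holonomyM gmulfM; apply/ffunP => i; rewrite !ffunE.
by case: (f _ i) => -[|[|[]]] // ?; apply: val_inj.
Qed.

Lemma holonomy_repr : exists s : {ffun 'I_n.-1 -> 'Z_2} -> G,
  (forall e e', L (s e) = L (s e') -> e = e') /\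
  (forall g, exists e, L g = L (s e)).
Proof.
have [f' fK f'K] := f_bij; exists (fun e => repr (f' e)); split=> [e e'|g].
  by move/pi_holonomy; rewrite !reprK => /(can_inj f'K).
exists (f (\pi_(holonomy_group Gamma)%qT g)); apply/pi_holonomy.
by rewrite reprK fK.
Qed.

(** Only finitely many linear parts occur, so the diagonalisation theorem for
finite families of commuting matrices applies. *)
Lemma linear_part_codiagonalizable : exists2 P : 'M[R]_n, P \in unitmx &
  forall g : G, is_diag_mx (P *m L g *m invmx P).
Proof.
have [s [_ s_surj]] := holonomy_repr.
pose As := [seq L (s e) | e : {ffun 'I_n.-1 -> 'Z_2}].
have [P Pu /allP PA] : codiagonalizable As.
  apply/codiagonalizableP; split=> [_ _ /mapP[e _ ->] /mapP[e' _ ->]|].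
    exact: linear_part_comm.
  move=> _ /mapP[e _ ->].
  by apply: involution_diagonalizable; rewrite ?pnatr_eq0 // linear_part_sqr.
exists P => // g; have [e ->] := s_surj g.
have : is_diag_mx (conjmx P (L (s e))).
  by apply: PA; apply: map_f; rewrite mem_enum.
by rewrite conjumx.
Qed.


Variable P : 'M[R]_n.
Hypothesis P_unit : P \in unitmx.
Hypothesis P_diag : forall g : G, is_diag_mx (P *m L g *m invmx P).

(** * The coordinates of a rigid motion *)

Definition eigensign (g : G) : {ffun 'I_n -> bool} :=
  [ffun k => (P *m L g *m invmx P) k k == -1].

Definition eigencoord (x : rigid_motion R n) (k : 'I_n) : R :=
  (P *m translation_part x) k 0.

Lemma conj_holonomyM (g h : G) : P *m L (g * h)%g *m invmx P =
  (P *m L g *m invmx P) *m (P *m L h *m invmx P).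
Proof. by rewrite holonomyM !mulmxA mulmxKV. Qed.

Lemma diag_mulE (A B : 'M[R]_n) i (m : nat) (C : 'M[R]_(n, m)) j :
  is_diag_mx A -> (A *m C) i j = A i i * C i j.
Proof.
move=> /is_diag_mxP dA; rewrite mxE (bigD1 i) //= big1 ?addr0 // => l li.
by rewrite dA ?mul0r // eq_sym.
Qed.

Lemma conj_holonomy_sign (g : G) k :
  (P *m L g *m invmx P) k k = (-1) ^+ (eigensign g k : bool).
Proof.
have : ((P *m L g *m invmx P) *m (P *m L g *m invmx P)) k k = 1.
  rewrite -conj_holonomyM holonomyM linear_part_sqr mulmx1 mulmxV //.
  by rewrite mxE eqxx.
rewrite diag_mulE // ffunE; set a := _ k k; have [->//|an] := eqVneq a (-1).
move=> aa; have /eqP : (a - 1) * (a + 1) = 0 by ring: aa.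
by rewrite mulf_eq0 subr_eq0 addr_eq0 (negPf an) orbF => /eqP.
Qed.

Lemma conj_holonomyE (g : G) : P *m L g *m invmx P =
  \matrix_(i, j) (if i == j then (-1) ^+ (eigensign g i : bool) else 0).
Proof.
apply/matrixP => i j; rewrite [RHS]mxE; have [->|ij] := eqVneq i j.
  by exact: conj_holonomy_sign.
by have /is_diag_mxP -> := P_diag g.
Qed.

Lemma eigensignM (g h : G) k :
  eigensign (g * h)%g k = eigensign g k (+) eigensign h k.
Proof.
apply: (@signr_inj R); rewrite signr_addb -!conj_holonomy_sign conj_holonomyM.
by rewrite diag_mulE.
Qed.

Lemma eigencoord_mul (g : G) (x : rigid_motion R n) k :
  eigencoord (val g * x)%g k =
  eigencoord (val g) k + (-1) ^+ (eigensign g k : bool) * eigencoord x k.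
Proof.
rewrite /eigencoord -conj_holonomy_sign -diag_mulE //.
rewrite -!mulmxA (mulmxA (invmx P)) mulVmx // mul1mx [LHS]/= mulmxDr mxE addrC.
by [].
Qed.

Lemma eigensign_inj (g h : G) : eigensign g = eigensign h -> L g = L h.
Proof.
move=> e; have : P *m L g *m invmx P = P *m L h *m invmx P.
  by rewrite !conj_holonomyE e.
move/(congr1 (fun A => invmx P *m A *m P)).
by rewrite -!mulmxA mulVmx // !mulmx1 !mulmxA mulVmx // !mul1mx.
Qed.

Lemma diag_faithful (g : G) : (forall k, eigensign g k = false) ->
  (forall k, eigencoord (val g) k = 0) -> g = 1%g.
Proof.
move=> sg pg; apply: val_inj; rewrite gmulf1; apply: val_inj.
have Lg : L g = L (1%g : G).
  apply: eigensign_inj; apply/ffunP => k; rewrite sg.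
  by have := eigensignM 1%g 1%g k; rewrite mulg1; case: (eigensign 1%g k).
have tg : translation_part (val g) = 0.
  rewrite -[LHS](mulKmx P_unit) (_ : P *m _ = 0) ?mulmx0 //.
  by apply/colP => k; rewrite [LHS]pg mxE.
move: Lg tg; rewrite gmulf1 /linear_part /translation_part /=.
by case: (val (val g)) => a b /= -> ->.
Qed.


(** * Discreteness and compactness *)

(** A translation along a single axis is small as a vector as soon as its
coordinate is small; then it lies in a neighbourhood of the identity that
contains no other element of Gamma. *)
Lemma eigencoord_discrete k : discrete_subgroup Gamma ->
  exists2 eps : R, 0 < eps & forall t : G,
    (forall i, eigensign t i = false) ->
    (forall i, i != k -> eigencoord (val t) i = 0) ->
    `|eigencoord (val t) k| < eps -> eigencoord (val t) k = 0.
Proof.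
pose inG (g : G) : set_type [set` Gamma]%classic :=
  exist _ (val g) (mem_set (valP g)).
move=> /(_ [set u | val u = 1%g]%classic) [A [B oB BA] AU].
have AP (g : G) : A (val g) <-> val g = 1%g.
  by rewrite -[A _]/((set_val @^-1` A)%classic (inG g)) AU.
have B1 : B (1%:M, 0).
  have /AP : val (1%g : G) = 1%g by rewrite gmulf1.
  by rewrite gmulf1 -BA.
have /nbhs_ballP[e /= e0 eB] : nbhs ((1%:M, 0) : 'M[R]_n * 'cV[R]_n) B.
  by apply: open_nbhs_nbhs.
pose c := 1 + \sum_j `|invmx P j k|.
have c0 : 0 < c by rewrite ltr_pwDl // sumr_ge0.
exists (e / c) => [|t st zt kt]; first exact: divr_gt0.
have Lt : L t = 1%:M.
  have -> : L t = L (1%g : G); last by rewrite gmulf1.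
  apply: eigensign_inj; apply/ffunP => i; rewrite st.
  by have := eigensignM 1%g 1%g i; rewrite mulg1; case: (eigensign 1%g i).
have At : A (val t).
  rewrite -BA /=; apply: eB; split; rewrite /= -/(linear_part (val t)) ?Lt.
    exact: ballxx.
  split=> // i j; rewrite mxE [j]ord1 -ball_normE /= sub0r normrN.
  rewrite -/(translation_part (val t)) -[translation_part _](mulKmx P_unit) mxE.
  rewrite (bigD1 k) //= big1 ?addr0 => [|l lk]; last first.
    by have := zt l lk; rewrite /eigencoord => ->; rewrite mulr0.
  rewrite normrM; apply: le_lt_trans (_ : c * `|eigencoord (val t) k| < e).
    apply: ler_wpM2r => //; rewrite /c (bigD1 i) //= addrCA lerDl addr_ge0 //.
    by rewrite sumr_ge0.
  by rewrite mulrC -ltr_pdivlMr.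
by rewrite (AP t).1 // /eigencoord mulmx0 mxE.
Qed.

Lemma eigencoord_inv_continuous k :
  continuous (fun x : rigid_motion R n => eigencoord x^-1%g k).
Proof.
have -> : (fun x : rigid_motion R n => eigencoord x^-1%g k) =
  (fun p : 'M[R]_n * 'cV[R]_n => (P *m - (p.1^T *m p.2)) k 0) \o val by [].
move=> x; apply: continuous_comp; first exact: initial_continuous.
have -> : (fun p : 'M[R]_n * 'cV[R]_n => (P *m - (p.1^T *m p.2)) k 0) =
  (fun p => \sum_i P k i * - (\sum_j p.1 j i * p.2 j 0)).
  apply/funext => p; rewrite mxE; apply: eq_bigr => i _; rewrite 2!mxE.
  by congr (_ * - _); apply: eq_bigr => j _; rewrite mxE.
apply: cvg_big => [|i _]; first exact: add_continuous.
apply: cvgM; first exact: cvg_cst.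
apply: cvgN; apply: cvg_big => [|j _]; first exact: add_continuous.
apply: cvgM.
  apply: (continuous_comp (f := fst) (g := fun A : 'M[R]_n => A j i)).
    exact: cvg_fst.
  exact: coord_continuous.
apply: (continuous_comp (f := snd) (g := fun A : 'cV[R]_n => A j 0)).
  exact: cvg_snd.
exact: coord_continuous.
Qed.

(** If no translation moved axis k, then the k-th coordinate would take only
finitely many values on Gamma, one for each element of the holonomy. In a
compact quotient the motions that send the origin further and further along
axis k have a cluster point, so some of them differ by elements of Gamma
from motions with bounded coordinate, which is a contradiction. *)
Lemma eigencoord_spanning k : cocompact_subgroup Gamma ->
  exists2 t : G, (forall i, eigensign t i = false) & eigencoord (val t) k != 0.
Proof.
move=> cocpt; apply: contrapT => none.
have flat (t : G) : (forall i, eigensign t i = false) ->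
    eigencoord (val t) k = 0.
  by move=> st; apply: contrapT => /eqP nz; apply: none; exists t.
have [s [_ s_surj]] := holonomy_repr.
pose C : R := \sum_e `|eigencoord (val (s e)) k|.
have bounded (g : G) : `|eigencoord (val g) k| <= C.
  have [e ge] := s_surj g.
  have -> : eigencoord (val g) k = eigencoord (val (s e)) k.
    have st i : eigensign (g * (s e)^-1)%g i = false.
      have : L (g * (s e)^-1)%g = L (1%g : G).
        by rewrite holonomyM holonomyV ge gmulf1 linear_part_mulmxtr.
      rewrite ffunE => ->.
      have := eigensignM 1%g 1%g i; rewrite mulg1 !ffunE.
      by case: (_ == _).
    rewrite -[g in LHS](mulgVK (s e)) gmulfM eigencoord_mul st flat //.
    by rewrite expr0 mul1r add0r.
  by rewrite /C (bigD1 e) //= lerDl sumr_ge0.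
(* The cosets are x Gamma, so the orbits of Gamma on space are seen through
   the inverses of the motions. *)
pose h (x : rigid_motion R n) := eigencoord x^-1%g k.
have hM x (g : G) : h (x * val g)%g =
    eigencoord (val g^-1%g) k + (-1) ^+ (eigensign g^-1%g k : bool) * h x.
  by rewrite /h invgM -gmulfV eigencoord_mul.
pose Q := quotient_topology (coset_space Gamma).
pose v (N : nat) : 'cV[R]_n := - (invmx P *m (N%:R *: delta_mx k 0)).
have vP N : is_rigid (1%:M, v N) by rewrite /is_rigid /= trmx1 mulmx1.
pose x N : rigid_motion R n := Sub _ (vP N).
have hx N : h (x N) = N%:R.
  rewrite /h /eigencoord /translation_part /= trmx1 mul1mx opprK.
  by rewrite mulKVmx // !mxE !eqxx mulr1.
have [q [_ q_cl]] :
    ([set: Q] `&` cluster ((fun N => \pi_Q%qT (x N)) @ \oo) !=set0)%classic.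
  by apply: cocpt; exact: filterT.
pose M := `|h (repr q)| + 1.
have piP y z : \pi_Q%qT y = \pi_Q%qT z <-> exists g : G, z = (y * val g)%g.
  split=> [/(@eqmodP _ (lcoset_equiv Gamma)) yz|[g ->]].
    by exists (Sub (y^-1 * z)%g yz); rewrite SubK mulVKg.
  apply/(@eqmodP _ (lcoset_equiv Gamma)).
  by rewrite /= /lcoset_rel mulKg; exact: valP.
pose W := [set \pi_Q%qT y | y in [set y | `|h y| < M]]%classic.
(* The cosets that contain a motion y with |h y| < M form an open set, since
   right multiplication by an element of Gamma changes h by an affine map. *)
have W_open : open W.
  rewrite /open /= /quotient_open.
  have -> : (\pi_Q%qT @^-1` W)%classic =
      (\bigcup_(g : G) [set y | `|h (y * val g)%g| < M])%classic.
    apply/seteqP; split=> y [].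
      move=> z hz /esym /piP[g gE]; exists g => //=; by rewrite -gE.
    by move=> g _ /= hg; exists (y * val g)%g => //; apply/esym/piP; exists g.
  apply: bigcup_open => g _.
  rewrite (_ : mkset _ = (fun y => eigencoord (val g^-1%g) k +
      (-1) ^+ (eigensign g^-1%g k : bool) * h y) @^-1` ball 0 M)%classic;
    last first.
    by apply/seteqP; split=> y; rewrite /= -ball_normE /= sub0r normrN hM.
  apply: open_comp => [y _|]; last exact: ball_open.
  exact: (cvgD (cvg_cst _) (cvgM (cvg_cst _) (@eigencoord_inv_continuous k y))).
have qW : nbhs q W.
  apply: open_nbhs_nbhs; split=> //; exists (repr q); last exact: reprK.
  by rewrite /= /M ltrDl.
have NW : (((fun N => \pi_Q%qT (x N)) @ \oo)
    [set \pi_Q%qT (x N) | N in [set N | (Num.truncn (M + C) < N)%N]])%classic.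
  by exists (Num.truncn (M + C)).+1 => // N /= lN; exists N.
have [_ [[N lN <-] [y /= hy /esym/piP[g yE]]]] := q_cl _ _ NW qW.
move: hy; rewrite yE hM hx; apply/negP; rewrite -leNgt.
have lN' : M + C < N%:R.
  apply: lt_le_trans (_ : (Num.truncn (M + C)).+1%:R <= _).
    exact: truncnS_gt.
  by rewrite ler_nat.
have := bounded g^-1%g; set a := eigencoord _ _.
have := ler_normB (a + (-1) ^+ (eigensign g^-1%g k : bool) * N%:R) a.
rewrite addrAC subrr add0r normrM normrX normrN1 expr1n mul1r ger0_norm //.
lra.
Qed.

End Holonomy.

Local Open Scope classical_set_scope.
Local Open Scope card_scope.

Theorem theorem7p1 (R : realType) (n : nat)
    (Gamma : groupClosed (rigid_motion R n)) (n_gt0 : (0 < n)%N)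
    (GHW_Gamma : GHW_group Gamma) :
  ([set: Out (subgroup Gamma)] #<= `I_(2 ^ n.+1 * n`!)) /\
  (center (subgroup Gamma) <> [set 1%g] ->
   [set: Out (subgroup Gamma)] #<= `I_(2 ^ n * (n.-1)`!)).
Proof.
have [[tf disc cocpt] [f f_bij]] := GHW_Gamma.
have [P P_unit P_diag] := linear_part_codiagonalizable f_bij.
have [s [s_inj _]] := holonomy_repr f_bij.
have cardE : #|{ffun 'I_n.-1 -> 'Z_2}| = (2 ^ n.-1)%N.
  by rewrite card_ffun !card_ord.
have s_sign e e' : eigensign P (s e) = eigensign P (s e') -> e = e'.
  by move/(eigensign_inj f_bij P_unit P_diag)/s_inj.
have chiM := eigensignM f_bij P_unit P_diag.
have posM (g h : subgroup Gamma) k :=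
  eigencoord_mul f_bij P_unit P_diag g (val h) k.
have faithful := diag_faithful f_bij P_unit P_diag.
have spanning k := eigencoord_spanning f_bij P_unit P_diag k cocpt.
have discrete k : exists2 eps : R, (0 < eps)%R & forall t : subgroup Gamma,
    on_axis (eigensign P) (fun g => eigencoord P (val g)) k t ->
    (`|eigencoord P (val t) k| < eps)%R -> eigencoord P (val t) k = 0%R.
  have [eps eps0 epsP] := eigencoord_discrete f_bij P_unit P_diag k disc.
  by exists eps => // t [st zt]; exact: epsP.
split.
  exact: (card_Out_le n_gt0 chiM posM faithful tf cardE s_sign spanning
    discrete).
exact: (card_Out_le_center n_gt0 chiM posM faithful tf cardE s_sign spanning
  discrete).
Qed.
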